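(* $\mathsf{GL}$ is strongly complete for the class of provability models with necessitation and Löb's rule: for every set $\Gamma\subseteq\mathcal L_\Box$ and every $A\in\mathcal L_\Box$, if for every provability model $\mathcal P$ with necessitation and Löb's rule and every world $w$ of $\mathcal P$, $\mathcal P,w\Vdash B$ for all $B\in\Gamma$ implies $\mathcal P,w\Vdash A$, then $A$ is derivable from $\Gamma$ together with the theorems of $\mathsf{GL}$ using modus ponens only (equivalently, $\mathsf{GL}\vdash\bigwedge\Delta\to A$ for some finite $\Delta\subseteq\Gamma$).
   Context: $\mathsf{GL}$ is $\mathsf K$ (the smallest normal modal logic) plus $\Box A\to\Box\Box A$ and $\Box(\Box A\to A)\to\Box A$. Language $\mathcal L_\Box$: formulas built from atomic propositions and $\bot$ using $\to$ and a unary $\Box$. A formula is purely modal if it is a Boolean combination of formulas $\Box B$. A theory is a pair of a set of axioms and a set of inference rules (finitely many premises, one conclusion); $\mathsf T\vdash A$ means derivability from axioms by rules. A theory is classical if modus ponens is one of its rules and all classical tautologies are derivable. A provability pre-model is $\mathcal P=(W,\sqsubset,\{L_w\}_{w\in W^\sqsubset},V)$ with $W$ nonempty, $\sqsubset$ a binary relation on $W$, $V\subseteq W\times\mathrm{atoms}$, $W^\sqsubset=\{u:\exists v\,(v\sqsubset u)\}$, and a theory $L_w$ for each $w\in W^\sqsubset$. Satisfaction: atoms via $V$, $\bot$ never holds, $\to$ classical, $\mathcal P,w\Vdash\Box A$ iff $L_u\vdash A$ for all $u$ with $w\sqsubset u$. With $\sqsubset^+$ the transitive closure, $\mathcal P,w\Vdash^+A$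 iff there is $u\sqsubset w$ with $\mathcal P,v\Vdash A$ for all $v$ such that $u\sqsubset^+v$. A provability model is a pre-model in which every $L_w$ is classical and which satisfies modal completeness: for every $w\in W^\sqsubset$ and purely modal $A$, $\mathcal P,w\Vdash^+A$ implies $L_w\vdash A$. Necessitation: every $L_w$ has the rule ''from $A$ infer $\Box A$''; Löb's rule: every $L_w$ has the rule ''from $\Box A\to A$ infer $A$''. *)

(* Defs.v *)
From Stdlib Require Import List Bool Relations.
Import ListNotations.

Set Implicit Arguments.
Unset Strict Implicit.

(** The set of atomic propositions is an arbitrary type throughout. *)
Inductive form (atom : Type) : Type :=
| Atom : atom -> form atom
| Bot : form atom
| Imp : form atom -> form atom -> form atom
| Box : form atom -> form atom.

Arguments Bot {atom}.

Inductive purely_modal (atom : Type) : form atom -> Prop :=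
| pm_box : forall B, purely_modal (Box B)
| pm_bot : purely_modal Bot
| pm_imp : forall B C,
    purely_modal B -> purely_modal C -> purely_modal (Imp B C).

(** Boolean evaluation in which atoms and boxed formulas receive arbitrary,
    independent truth values. *)
Fixpoint beval (atom : Type) (va : atom -> bool) (vb : form atom -> bool)
    (A : form atom) : bool :=
  match A with
  | Atom p => va p
  | Bot => false
  | Imp B C => implb (beval va vb B) (beval va vb C)
  | Box B => vb B
  end.

Definition tautology (atom : Type) (A : form atom) : Prop :=
  forall va vb, beval va vb A = true.

(** An inference rule, given by its instances: a finite list of premises and a
    conclusion. *)
Definition rule (atom : Type) : Type := list (form atom) -> form atom -> Prop.

Record theory (atom : Type) : Type := Theory {
  axioms : form atom -> Prop;
  rules : rule atom -> Prop
}.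

Inductive derives (atom : Type) (T : theory atom) : form atom -> Prop :=
| derives_axiom : forall A, axioms T A -> derives T A
| derives_rule : forall (r : rule atom) (prems : list (form atom)) A,
    rules T r -> r prems A ->
    (forall B, In B prems -> derives T B) -> derives T A.

Definition modus_ponens (atom : Type) : rule atom :=
  fun prems C => exists A, prems = [A; Imp A C].

Definition necessitation (atom : Type) : rule atom :=
  fun prems C => exists A, prems = [A] /\ C = Box A.

Definition loeb_rule (atom : Type) : rule atom :=
  fun prems C => prems = [Imp (Box C) C].

Definition classical (atom : Type) (T : theory atom) : Prop :=
  rules T (@modus_ponens atom) /\ forall A, tautology A -> derives T A.

Definition theory_K (atom : Type) : theory atom := {|
  axioms := fun C =>
    tautology C \/
    exists A B, C = Imp (Box (Imp A B)) (Imp (Box A) (Box B));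
  rules := fun r => r = @modus_ponens atom \/ r = @necessitation atom
|}.

Definition GL (atom : Type) : theory atom := {|
  axioms := fun C =>
    axioms (theory_K atom) C \/
    (exists A, C = Imp (Box A) (Box (Box A))) \/
    (exists A, C = Imp (Box (Imp (Box A) A)) (Box A));
  rules := rules (theory_K atom)
|}.

(** The theory whose derivations start from [Gamma] and the theorems of [GL]
    and use modus ponens only. *)
Definition GL_from (atom : Type) (Gamma : form atom -> Prop) : theory atom := {|
  axioms := fun B => Gamma B \/ derives (GL atom) B;
  rules := fun r => r = @modus_ponens atom
|}.

(** The set written W^⊏: the worlds that have a predecessor. *)
Definition has_pred (W : Type) (R : W -> W -> Prop) : Type :=
  {u : W | exists v, R v u}.

Record premodel (atom : Type) : Type := Premodel {
  world : Type;
  world_nonempty : inhabited world;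
  rel : world -> world -> Prop;
  thy : has_pred rel -> theory atom;
  val : world -> atom -> Prop
}.

Fixpoint sat (atom : Type) (P : premodel atom) (w : world P) (A : form atom)
    : Prop :=
  match A with
  | Atom p => val w p
  | Bot => False
  | Imp B C => sat w B -> sat w C
  | Box B => forall u : has_pred (@rel _ P),
      rel w (proj1_sig u) -> derives (thy u) B
  end.

Definition sat_plus (atom : Type) (P : premodel atom) (w : world P)
    (A : form atom) : Prop :=
  exists u : world P, rel u w /\
    forall v, clos_trans (world P) (@rel _ P) u v -> sat v A.

Definition modally_complete (atom : Type) (P : premodel atom) : Prop :=
  forall (w : has_pred (@rel _ P)) (A : form atom), purely_modal A ->
    sat_plus (proj1_sig w) A -> derives (thy w) A.

Definition provability_model (atom : Type) (P : premodel atom) : Prop :=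
  (forall w : has_pred (@rel _ P), classical (thy w)) /\ modally_complete P.

Definition with_necessitation (atom : Type) (P : premodel atom) : Prop :=
  forall w : has_pred (@rel _ P), rules (thy w) (@necessitation atom).

Definition with_loeb (atom : Type) (P : premodel atom) : Prop :=
  forall w : has_pred (@rel _ P), rules (thy w) (@loeb_rule atom).

(* Main.v *)
From Stdlib Require Import List Relations Classical.
From mathcomp Require classical_sets.
Require Import Defs.
Import ListNotations.

(** Canonical model.  The worlds are pairs [(m, n)] of maximal [GL]-consistent
    sets; [n] says what is true at the world, [m] remembers the predecessor, and
    the theory of the world is [{B | Box B \in m}].  Löb's axiom and transitivity
    make this theory closed under Löb's rule and necessitation.  All successors
    of a world thus carry the same theory, which yields the truth lemma for
    boxes.  Modal completeness is the usual existence lemma: a formula true in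
    all successors of [m] is boxed in [m].  No well-foundedness is needed, which
    is why strong completeness does not fail as it does for Kripke frames. *)

Section Canonical.

Variable atom : Type.

Implicit Types (A B C : form atom) (X G M : form atom -> Prop).

(** * Derivability from assumptions and theorems of [GL] *)

Lemma GL_from_mp G A B :
  derives (GL_from G) A -> derives (GL_from G) (Imp A B) ->
  derives (GL_from G) B.
Proof.
  intros HA HAB.
  apply (derives_rule (r := @modus_ponens atom) (prems := [A; Imp A B])).
  - reflexivity.
  - now exists A.
  - now intros C [<- | [<- | []]].
Qed.

Lemma GL_from_assumption G A : G A -> derives (GL_from G) A.
Proof. intros HA; apply derives_axiom; now left. Qed.

Lemma GL_from_theorem G A : derives (GL atom) A -> derives (GL_from G) A.
Proof. intros HA; apply derives_axiom; now right. Qed.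

Lemma GL_tautology A : tautology A -> derives (GL atom) A.
Proof. intros HA; apply derives_axiom; now left; left. Qed.

Lemma GL_from_tautology G A : tautology A -> derives (GL_from G) A.
Proof. intros HA; now apply GL_from_theorem, GL_tautology. Qed.

Lemma GL_nec A : derives (GL atom) A -> derives (GL atom) (Box A).
Proof.
  intros HA.
  apply (derives_rule (r := @necessitation atom) (prems := [A])).
  - now right.
  - now exists A.
  - now intros C [<- | []].
Qed.

Lemma GL_from_ind G (Q : form atom -> Prop) :
  (forall A, G A -> Q A) -> (forall A, derives (GL atom) A -> Q A) ->
  (forall A B, Q A -> Q (Imp A B) -> Q B) ->
  forall A, derives (GL_from G) A -> Q A.
Proof.
  intros HG HGL Hmp A HA.
  induction HA as [A [HA | HA] | r prems A Hr Hprems _ IH].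
  - now apply HG.
  - now apply HGL.
  - cbn in Hr; subst r; destruct Hprems as [B ->].
    apply Hmp with B; apply IH; cbn; tauto.
Qed.

Lemma GL_from_mono G X A :
  (forall B, G B -> X B) -> derives (GL_from G) A -> derives (GL_from X) A.
Proof.
  intros HGX; apply GL_from_ind.
  - intros B HB; now apply GL_from_assumption, HGX.
  - apply GL_from_theorem.
  - apply GL_from_mp.
Qed.

Ltac taut :=
  apply GL_from_tautology; intros va vb; cbn;
  repeat match goal with |- context [beval va vb ?B] =>
    destruct (beval va vb B) end; reflexivity.

(** Modus ponens is the only rule of [GL_from]: necessitation acts only inside [GL], whose theorems
    count as axioms here. *)
Lemma deduction G A B :
  derives (GL_from (fun C => G C \/ C = A)) B -> derives (GL_from G) (Imp A B).
Proof.
  assert (weaken : forall C,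
            derives (GL_from G) C -> derives (GL_from G) (Imp A C)).
  { intros C HC; apply (GL_from_mp _ C); [assumption | taut]. }
  apply (GL_from_ind _ (fun C => derives (GL_from G) (Imp A C))).
  - intros C [HC | ->]; [now apply weaken, GL_from_assumption | taut].
  - intros C HC; now apply weaken, GL_from_theorem.
  - intros C D HC HCD.
    apply (GL_from_mp _ (Imp A C)); [assumption |].
    apply (GL_from_mp _ (Imp A (Imp C D))); [assumption | taut].
Qed.

(** * Maximal consistent sets and Lindenbaum's lemma *)

Definition maximal_consistent M : Prop :=
  (forall B, derives (GL_from M) B -> M B) /\
  (forall B, M (Imp B Bot) <-> ~ M B).

(* The disjunct [X = fun _ => False] accounts for the empty chain. *)
Lemma chain_compact G (F : (form atom -> Prop) -> Prop) A :
  (forall X Y, F X -> F Y ->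
     (forall B, X B -> Y B) \/ (forall B, Y B -> X B)) ->
  derives (GL_from (fun B => G B \/ exists2 X, F X & X B)) A ->
  exists X, (F X \/ X = fun _ => False) /\
    derives (GL_from (fun B => G B \/ X B)) A.
Proof.
  intros chain.
  apply (GL_from_ind _ (fun A => exists X, (F X \/ X = fun _ => False) /\
    derives (GL_from (fun B => G B \/ X B)) A)).
  - intros B [HB | [X FX XB]].
    + exists (fun _ => False); split; [now right |].
      now apply GL_from_assumption; left.
    + exists X; split; [now left |].
      now apply GL_from_assumption; right.
  - intros B HB; exists (fun _ => False); split; [now right |].
    now apply GL_from_theorem.
  - intros B C [X [FX HX]] [Y [FY HY]].
    assert (HXY : (forall B, X B -> Y B) \/ (forall B, Y B -> X B)).
    { destruct FX as [FX | ->]; [| now left].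
      destruct FY as [FY | ->]; [now apply chain | now right]. }
    destruct HXY as [HXY | HXY]; [exists Y | exists X];
      (split; [assumption |]); apply GL_from_mp with B; trivial;
      [refine (GL_from_mono _ _ _ _ HX)
      | refine (GL_from_mono _ _ _ _ HY)];
      intros D [HD | HD]; auto.
Qed.

Lemma lindenbaum G A :
  ~ derives (GL_from G) A ->
  exists M, maximal_consistent M /\ (forall B, G B -> M B) /\ ~ M A.
Proof.
  intros HA.
  (* Zorn is applied to the sets [X] added to [G], not to supersets of [G], so that the empty union
     is also admissible. *)
  destruct (@classical_sets.Zorn_bigcup _
              (fun X => ~ derives (GL_from (fun B => G B \/ X B)) A))
    as [X [HX Xmax]].
  { intros F FP chain HF.
    apply chain_compact in HF; [| intros X Y FX FY; exact (chain X Y FX FY)].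
    destruct HF as [X [[FX | ->] HX]].
    - exact (FP X FX HX).
    - apply HA; revert HX; apply GL_from_mono; tauto. }
  set (M := fun B => G B \/ X B) in *.
  (* Adding [B] to [X] is a proper extension, so by maximality it makes [A] derivable. *)
  assert (Mmax : forall B, ~ M B -> derives (GL_from M) (Imp B A)).
  { intros B HB; apply deduction, NNPP; intros Hder.
    apply (Xmax (fun C => X C \/ C = B)).
    - split; [intros C HC; now left |].
      intros sub; apply HB; right; apply sub; now right.
    - intros Hder'; apply Hder; revert Hder'; apply GL_from_mono.
      unfold M; tauto. }
  exists M; repeat split.
  - intros B HB; apply NNPP; intros HMB.
    now apply HX, GL_from_mp with B, Mmax.
  - intros HnB HB; apply HX.
    apply GL_from_mp with B; [now apply GL_from_assumption |].
    apply GL_from_mp with (Imp B Bot); [now apply GL_from_assumption | taut].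
  (* If [B] and its negation were both missing, each would imply [A], so [A] would follow by
     cases. *)
  - intros HB; apply NNPP; intros HnB; apply HX.
    apply (GL_from_mp _ (Imp B A)); [now apply Mmax |].
    apply (GL_from_mp _ (Imp (Imp B Bot) A)); [now apply Mmax | taut].
  - now left.
  - intros HMA; now apply HX, GL_from_assumption.
Qed.

(** * Boxes in a maximal consistent set *)

Section MaximalConsistent.

Variable M : form atom -> Prop.
Hypothesis mcM : maximal_consistent M.

Lemma mcs_theorem A : derives (GL atom) A -> M A.
Proof. intros HA; now apply (proj1 mcM), GL_from_theorem. Qed.

Lemma mcs_mp A B : M A -> M (Imp A B) -> M B.
Proof.
  intros HA HAB; apply (proj1 mcM), GL_from_mp with A;
    now apply GL_from_assumption.
Qed.

Lemma mcs_bot : ~ M Bot.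
Proof.
  apply (proj2 mcM), mcs_theorem, GL_tautology; intros va vb; reflexivity.
Qed.

Lemma mcs_imp A B : M (Imp A B) <-> (M A -> M B).
Proof.
  split; [intros HAB HA; now apply mcs_mp with A |].
  intros HAB; apply (proj1 mcM).
  destruct (classic (M A)) as [HA | HA].
  - apply GL_from_mp with B; [now apply GL_from_assumption, HAB | taut].
  - apply (proj2 mcM) in HA.
    apply GL_from_mp with (Imp A Bot); [now apply GL_from_assumption | taut].
Qed.

Lemma mcs_box_mp A B : M (Box A) -> M (Box (Imp A B)) -> M (Box B).
Proof.
  intros HA HAB; apply mcs_mp with (Box A); [assumption |].
  apply mcs_mp with (Box (Imp A B)); [assumption |].
  apply mcs_theorem, derives_axiom; left; right; now exists A, B.
Qed.

Lemma mcs_box_theorem A : derives (GL atom) A -> M (Box A).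
Proof. intros HA; now apply mcs_theorem, GL_nec. Qed.

Lemma mcs_box_trans A : M (Box A) -> M (Box (Box A)).
Proof.
  intros HA; apply mcs_mp with (Box A); [assumption |].
  apply mcs_theorem, derives_axiom; right; left; now exists A.
Qed.

Lemma mcs_box_loeb A : M (Box (Imp (Box A) A)) -> M (Box A).
Proof.
  intros HA; apply mcs_mp with (Box (Imp (Box A) A)); [assumption |].
  apply mcs_theorem, derives_axiom; right; right; now exists A.
Qed.

(** By necessitation and axiom K, whatever follows from the formulas boxed in [M] is itself boxed in
    [M]; hence they do not derive [A]. *)
Lemma mcs_existence A :
  ~ M (Box A) ->
  exists N, maximal_consistent N /\ (forall B, M (Box B) -> N B) /\ ~ N A.
Proof.
  intros HA; apply lindenbaum; intros HdA; apply HA; revert HdA.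
  apply (GL_from_ind _ (fun B => M (Box B))).
  - trivial.
  - exact mcs_box_theorem.
  - exact mcs_box_mp.
Qed.

Definition boxed_theory : theory atom := {|
  axioms := fun B => M (Box B);
  rules := fun r =>
    r = @modus_ponens atom \/ r = @necessitation atom \/ r = @loeb_rule atom
|}.

(** Each rule is absorbed by an axiom of [GL]: modus ponens by K, necessitation by transitivity,
    Löb's rule by Löb's axiom. *)
Lemma derives_boxed_theory A : derives boxed_theory A <-> M (Box A).
Proof.
  split; [| intros HA; now apply derives_axiom].
  induction 1 as [A HA | r prems A Hr Hprems _ IH]; [assumption |].
  cbn in Hr; destruct Hr as [-> | [-> | ->]].
  - destruct Hprems as [B ->].
    apply mcs_box_mp with B; apply IH; cbn; tauto.
  - destruct Hprems as [B [-> ->]].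
    apply mcs_box_trans, IH; now left.
  - unfold loeb_rule in Hprems; subst prems.
    apply mcs_box_loeb, IH; now left.
Qed.

Lemma boxed_theory_classical : classical boxed_theory.
Proof.
  split; [now left |].
  intros A HA; now apply derives_boxed_theory, mcs_box_theorem, GL_tautology.
Qed.

End MaximalConsistent.

(** * The canonical provability model *)

Definition mcs : Type := {M : form atom -> Prop | maximal_consistent M}.

Definition canonical_rel (x y : mcs * mcs) : Prop :=
  fst y = snd x /\
  forall B, proj1_sig (snd x) (Box B) -> proj1_sig (snd y) B.

Definition canonical_premodel (m : mcs) : premodel atom := {|
  world := mcs * mcs;
  world_nonempty := inhabits (m, m);
  rel := canonical_rel;
  thy := fun u : has_pred canonical_rel =>
    boxed_theory (proj1_sig (fst (proj1_sig u)));
  val := fun x p => proj1_sig (snd x) (Atom p)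
|}.

Lemma canonical_existence (k n : mcs) A :
  ~ proj1_sig n (Box A) ->
  exists2 d : mcs, canonical_rel (k, n) (n, d) & ~ proj1_sig d A.
Proof.
  intros HA.
  destruct (mcs_existence (proj1_sig n) (proj2_sig n) A HA)
    as [N [mcN [sub HN]]].
  now exists (exist _ N mcN).
Qed.

Lemma truth_lemma m A (x : world (canonical_premodel m)) :
  sat x A <-> proj1_sig (snd x) A.
Proof.
  induction A as [p | | A IHA B IHB | A _]; cbn.
  - reflexivity.
  - split; [easy | exact (mcs_bot _ (proj2_sig (snd x)))].
  - rewrite IHA, IHB; symmetry; apply mcs_imp, proj2_sig.
  - destruct x as [k n]; cbn; split.
    + intros HA; apply NNPP; intros HnA; apply HnA.
      (* A world without successors satisfies every box; the absence of [Box A] from [n] guarantees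
         a successor, and its theory is read off [n]. *)
      destruct (canonical_existence k n A HnA) as [d Hd _].
      specialize (HA (exist _ (n, d) (ex_intro _ (k, n) Hd)) Hd).
      now apply derives_boxed_theory in HA; [| apply proj2_sig].
    + intros HA u [Hu _]; cbn in Hu; rewrite Hu.
      now apply derives_axiom.
Qed.

Lemma canonical_provability_model m : provability_model (canonical_premodel m).
Proof.
  split.
  - intros u; apply boxed_theory_classical, proj2_sig.
  (* The witness of [sat_plus] precedes [(n, d)], so its second component is [n], the set that
     defines the theory of [(n, d)]. *)
  - intros [[n d] Hu] A _ [[k n'] [[Hn _] Hsat]]; cbn in Hn |- *; subst n'.
    apply derives_axiom, NNPP; intros HnA.
    destruct (canonical_existence k n A HnA) as [e He HeA].
    apply HeA.
    apply (truth_lemma m A (n, e)), Hsat; now apply t_step.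
Qed.

End Canonical.

Theorem theorem3p18 (atom : Type) (Gamma : form atom -> Prop) (A : form atom) :
  (forall P : premodel atom,
     provability_model P -> with_necessitation P -> with_loeb P ->
     forall w : world P,
       (forall B : form atom, Gamma B -> sat w B) -> sat w A) ->
  derives (GL_from Gamma) A.
Proof.
  intros Hval; apply NNPP; intros HA.
  destruct (lindenbaum atom Gamma A HA) as [M [mcM [HG HM]]].
  set (m := exist _ M mcM : mcs atom).
  (* Truth at a world depends on its second component, so any first component would do. *)
  apply HM, (truth_lemma atom m A (m, m)), Hval.
  - apply canonical_provability_model.
  - intros u; right; left; reflexivity.
  - intros u; right; right; reflexivity.
  - intros B HB; apply truth_lemma; now apply HG.
Qed.
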